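(* Let $\underline{q}=(q_1,\dots,q_N)$ be a probability vector and let $\mathbf{w}\in\{1,\dots,N\}^{\mathbb{N}}$ be a $\underline{q}$-frequency regular sequence. Let $(f_{j,i})_{1\le j\le N,\,1\le i\le K}$ be real numbers, and suppose that $g_i=\sum_{j=1}^Nq_jf_{j,i}$ is not constant as a function of $i\in\{1,\dots,K\}$. Let $$D_{\mathbf{w}}=\Big\{\mathbf{i}\in\{1,\dots,K\}^{\mathbb{N}}:\lim_{n\to\infty}\frac1n\sum_{k=0}^{n-1}f_{w_k,i_k}\text{ does not exist}\Big\}.$$ Then $h_{\rm top}(D_{\mathbf{w}})=\log K$.
   Context: $\mathbb{N}=\{0,1,2,\dots\}$ and $\Sigma=\{1,\dots,K\}^{\mathbb{N}}$. A sequence $\mathbf{w}=(w_0,w_1,\dots)\in\{1,\dots,N\}^{\mathbb{N}}$ is $\underline{q}$-frequency regular if $\lim_{n\to\infty}\frac1n\#\{k\in[0,n]\cap\mathbb{Z}:w_k=i\}=q_i$ for every $i=1,\dots,N$. Topological entropy of $E\subseteq\Sigma$: the level $l(C)$ of a cylinder $C$ is the length of its defining word; $\mathcal{H}^s_r(E)=\inf\sum_{C}e^{-s\,l(C)}$ over covers of $E$ by cylinders of level larger than $r$; $\mathcal{H}^s(E)=\lim_{r\to\infty}\mathcal{H}^s_r(E)$; $h_{\rm top}(E)=\inf\{s\ge0:\mathcal{H}^s(E)<\infty\}$ for $E\ne\emptyset$, and $h_{\rm top}(\emptyset)=-\infty$. *)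

(* Defs.v *)
From HB Require Import structures.
From mathcomp Require Import all_boot all_order all_algebra.
From mathcomp Require Import all_classical all_reals all_analysis.

Set Implicit Arguments.
Unset Strict Implicit.
Unset Printing Implicit Defensive.

Import Order.TTheory GRing.Theory Num.Theory.
Import numFieldNormedType.Exports.

Local Open Scope classical_set_scope.
Local Open Scope ring_scope.

(* The alphabets {1, ..., K} and {1, ..., N} are 'I_K and 'I_N, and the sequence
   space {1, ..., K}^N is nat -> 'I_K. *)

Definition probability_vector (R : realType) (N : nat) (q : 'I_N -> R) : Prop :=
  (forall j, 0 <= q j) /\ \sum_(j < N) q j = 1.

(* The count is over the n + 1 integers of [0, n]; dividing by n = 0 gives 0,
   which does not affect the limit. *)
Definition frequency_regular (R : realType) (N : nat) (q : 'I_N -> R)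
    (w : nat -> 'I_N) : Prop :=
  forall i : 'I_N,
    #|[set k : 'I_n.+1 | w k == i]%SET|%:R / n%:R @[n --> \oo] --> q i.

Section TopologicalEntropy.
Context {R : realType} {K : nat}.

Definition cylinder (u : seq 'I_K) : set (nat -> 'I_K) :=
  [set x | mkseq x (size u) = u].

(* Cylinders are represented by their defining words, so that the level is the
   length of the word. There are countably many words, hence every such cover
   is countable. *)
Definition cylinder_cover (r : nat) (E : set (nat -> 'I_K)) :
    set (set (seq 'I_K)) :=
  [set C | (forall u, C u -> (r < size u)%N) /\
           E `<=` \bigcup_(u in C) cylinder u].

Definition entropy_premeasure (s : R) (r : nat) (E : set (nat -> 'I_K)) :
    \bar R :=
  ereal_inf [set (\esum_(u in C) (expR (- s * (size u)%:R))%:E)%E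
            | C in cylinder_cover r E].

Definition entropy_measure (s : R) (E : set (nat -> 'I_K)) : \bar R :=
  limn (fun r => entropy_premeasure s r E).

Definition htop (E : set (nat -> 'I_K)) : \bar R :=
  if `[< E = set0 >] then -oo%E
  else ereal_inf
    [set s%:E | s in [set s : R | 0 <= s /\ (entropy_measure s E < +oo)%E]].

End TopologicalEntropy.
Arguments htop R {K} E.

Definition divergence_set (R : realType) (N K : nat) (w : nat -> 'I_N)
    (f : 'I_N -> 'I_K -> R) : set (nat -> 'I_K) :=
  [set x | ~ cvg ((n%:R^-1 * \sum_(0 <= k < n) f (w k) (x k)) @[n --> \oo])].

(* Main.v *)
(* For two letters a, b with different averages g and a set P of positions of
   upper density at most 2/m, overwrite an arbitrary sequence z by a, respectively
   b, on P. The averages of the two results differ by the averages of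
   f_{w_k,b} - f_{w_k,a} restricted to P. With P the union of the blocks
   [m 4^j, (m+1) 4^j) these diverge: a limit would have to be g_b - g_a along the
   blocks, and 0 along the gaps [2m 4^j, 4m 4^j). Hence at least one of the two
   overwritten sequences lies in D, and every cover of D by cylinders yields a
   cover of the whole sequence space once the letters on P are forgotten. A Kraft
   inequality then bounds its entropy sum from below with exponent
   (1 - 2/m) log K. *)
Require Import Defs.
From mathcomp Require Import all_boot all_order all_algebra.
From mathcomp Require Import all_classical all_reals all_analysis.
From mathcomp Require Import zify lra ring.

Set Implicit Arguments.
Unset Strict Implicit.
Unset Printing Implicit Defensive.

Import Order.TTheory GRing.Theory Num.Theory.
Import numFieldNormedType.Exports.

Local Open Scope classical_set_scope.
Local Open Scope ring_scope.

(** * Averages along a frequency regular sequence *)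

Lemma avg_frequency_regular (R : realType) (N : nat) (q h : 'I_N -> R)
    (w : nat -> 'I_N) : frequency_regular q w ->
  n%:R^-1 * \sum_(0 <= k < n) h (w k) @[n --> \oo] --> \sum_j h j * q j.
Proof.
move=> hw.
(* The frequencies count n + 1 positions but are divided by n, so the sum with n + 1 terms, grouped
   by letter, is treated first. *)
have avgS : n%:R^-1 * \sum_(0 <= k < n.+1) h (w k) @[n --> \oo]
    --> \sum_j h j * q j.
  have -> : (fun n : nat => n%:R^-1 * \sum_(0 <= k < n.+1) h (w k)) =
      (fun n : nat =>
         \sum_j h j * (#|[set k : 'I_n.+1 | w k == j]%SET|%:R / n%:R)).
    apply/funext => n.
    rewrite big_mkord (partition_big (fun k : 'I_n.+1 => w k) xpredT)//=.
    rewrite mulr_sumr; apply: eq_bigr => j _.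
    rewrite (eq_bigr (fun=> h j)) => [|k /eqP -> //].
    rewrite sumr_const -(mulr_natr (h j)) mulrC -mulrA.
    by congr (_ * (_%:R * _)); apply: eq_card => k; rewrite !inE.
  by apply: cvg_big => [|j _]; [exact: add_continuous|apply: cvgMr (hw j)].
(* The surplus last term vanishes in the limit, since [h] takes finitely many values, all bounded by
   [M]. *)
have bnd : h (w n) * n%:R^-1 @[n --> \oo] --> (0 : R).
  pose M : R := \sum_j `|h j|.
  have inv0 : (n%:R^-1 : R) @[n --> \oo] --> (0 : R).
    by rewrite -cvg_shiftS; exact: cvg_harmonic.
  apply: (@squeeze_cvgr _ _ _ _
    (fun n => - M * n%:R^-1) (fun n => M * n%:R^-1)).
  - apply: nearW => n; rewrite mulNr -ler_norml normrM.
    rewrite (ger0_norm (x := _^-1)) ?invr_ge0// ler_wpM2r ?invr_ge0//.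
    by rewrite /M (bigD1 (w n))//= lerDl sumr_ge0.
  - by rewrite -(mulr0 (- M)); exact: cvgMr.
  - by rewrite -(mulr0 M); exact: cvgMr.
rewrite -[X in _ --> X]subr0.
rewrite (_ : (fun n : nat => _) = (fun n : nat =>
  n%:R^-1 * (\sum_(0 <= k < n.+1) h (w k)) - h (w n) * n%:R^-1)).
  exact: cvgB.
by apply/funext => n; rewrite big_nat_recr//= mulrDr (mulrC (h _)) addrK.
Qed.

(** * A sparse union of blocks: density and divergence *)

Definition sparse (m k : nat) : bool :=
  `[< exists j, (m * 4 ^ j <= k < m.+1 * 4 ^ j)%N >].

Lemma sparseF (m j k : nat) :
  (m.+1 * 4 ^ j <= k < m * 4 ^ j.+1)%N -> sparse m k = false.
Proof.
move=> /andP[jk kj]; apply/asboolPn => -[i /andP[ik ki]].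
have [ij|ji] := leqP i j.
  have := leq_ltn_trans jk ki.
  by rewrite ltn_mul2l ltn_exp2l// => /andP[_]; rewrite ltnNge ij.
have := leq_ltn_trans ik kj.
by rewrite ltn_mul2l ltn_exp2l// => /andP[_]; rewrite ltnNge ji.
Qed.

(** By induction on j: the only new block has length 4^j, and 4^j + 4^j <= 4^(j+1). *)
Lemma sparse_count_pow (m j : nat) :
  (0 < m -> \sum_(0 <= k < m * 4 ^ j) sparse m k <= 4 ^ j)%N.
Proof.
move=> m0; elim: j => [|j ih].
  rewrite expn0 muln1 big_nat big1// => k km; apply/eqP; rewrite eqb0.
  apply/asboolPn => -[i /andP[ik _]].
  have : (m * 4 ^ i < m * 1)%N by rewrite muln1 (leq_ltn_trans ik).
  by rewrite ltn_mul2l m0 ltnS leqNgt expn_gt0.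
have le1 : (m * 4 ^ j <= m.+1 * 4 ^ j)%N by rewrite leq_mul2r leqnSn orbT.
have le2 : (m.+1 * 4 ^ j <= m * 4 ^ j.+1)%N.
  by rewrite expnS mulnA leq_mul2r (leq_trans (n := m * 2)) ?orbT//; lia.
rewrite (big_cat_nat (leq0n _) (leq_trans le1 le2))/=.
rewrite (big_cat_nat le1 le2)/= [X in (_ + (_ + X))%N]big_nat.
rewrite [X in (_ + (_ + X))%N]big1 => [|k /sparseF -> //]; rewrite addn0.
have : (\sum_(m * 4 ^ j <= k < m.+1 * 4 ^ j) sparse m k <= 4 ^ j)%N.
  apply: (@leq_trans (\sum_(m * 4 ^ j <= k < m.+1 * 4 ^ j) 1)%N).
    by apply: leq_sum => k _; exact: leq_b1.
  by rewrite sum_nat_const_nat muln1 mulSn addnK.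
rewrite expnS; lia.
Qed.

(** Below m there are no blocks. Otherwise take j with m 4^j <= n < m 4^(j+1): at most 4^j positions
    precede block j and at most 4^j lie in it, while 2 m 4^j <= 2 n. *)
Lemma sparse_count (m n : nat) :
  (0 < m -> m * \sum_(0 <= k < n) sparse m k <= 2 * n)%N.
Proof.
move=> m0.
have mono (a b : nat) : (a <= b)%N ->
    (\sum_(0 <= k < a) sparse m k <= \sum_(0 <= k < b) sparse m k)%N.
  by move=> ab; rewrite (big_cat_nat (leq0n _) ab)/= leq_addr.
have [nm|mn] := ltnP n m.
  rewrite big_nat big1 ?muln0// => k /andP[_ kn]; apply/eqP; rewrite eqb0.
  apply/asboolPn => -[i /andP[ik _]].
  have : (m * 4 ^ i < m * 1)%N.
    by rewrite muln1 (leq_ltn_trans ik)// (ltn_trans kn).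
  by rewrite ltn_mul2l m0 ltnS leqNgt expn_gt0.
have /andP[jn nj] : (m * 4 ^ trunc_log 4 (n %/ m) <= n
    < m * 4 ^ (trunc_log 4 (n %/ m)).+1)%N.
  rewrite mulnC -leq_divRL// trunc_logP ?divn_gt0//= mulnC -ltn_divLR//.
  exact: trunc_log_ltn.
set j := trunc_log _ _ in jn nj *.
suff : (\sum_(0 <= k < n) sparse m k <= 2 * 4 ^ j)%N.
  move=> /(leq_mul (leqnn m)) /leq_trans; apply.
  by rewrite mulnCA leq_mul2l.
have [nle|lt_n] := leqP n (m.+1 * 4 ^ j).
  rewrite (big_cat_nat (leq0n _) jn)/= mul2n -addnn leq_add ?sparse_count_pow//.
  apply: (@leq_trans (\sum_(m * 4 ^ j <= k < n) 1)%N).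
    by apply: leq_sum => k _; exact: leq_b1.
  by rewrite sum_nat_const_nat muln1 leq_subLR addnC -mulSn.
rewrite (big_cat_nat (leq0n _) (ltnW lt_n))/= [X in (_ + X)%N]big_nat.
rewrite [X in (_ + X)%N]big1 => [|k /andP[k1 k2]]; last first.
  by rewrite (@sparseF m j)// k1 (ltn_trans k2).
rewrite addn0.
have jj : (m * 4 ^ j <= m.+1 * 4 ^ j)%N by rewrite leq_mul2r leqnSn orbT.
rewrite (big_cat_nat (leq0n _) jj)/= mul2n -addnn leq_add ?sparse_count_pow//.
apply: (@leq_trans (\sum_(m * 4 ^ j <= k < m.+1 * 4 ^ j) 1)%N).
  by apply: leq_sum => k _; exact: leq_b1.
by rewrite sum_nat_const_nat muln1 mulSn addnK.
Qed.

Lemma sparse_avg_diverges (R : realType) (h : nat -> R) (d : R) (m : nat) :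
  (0 < m)%N -> d != 0 ->
  n%:R^-1 * \sum_(0 <= k < n) h k @[n --> \oo] --> d ->
  ~ cvg (n%:R^-1 * \sum_(0 <= k < n) (if sparse m k then h k else 0)
         @[n --> \oo]).
Proof.
move=> m0 d0 hd /cvg_ex[/= l hl].
(* Along n = c 4^j, dividing by 4^j instead of n multiplies the limit by c. *)
have sub (c : nat) (u : nat -> R) (x : R) : (0 < c)%N ->
    n%:R^-1 * u n @[n --> \oo] --> x ->
    (4 ^+ j)^-1 * u (c * 4 ^ j)%N @[j --> \oo] --> c%:R * x.
  move=> c0 ux.
  have c4 : (c * 4 ^ j)%N @[j --> \oo] --> \oo.
    apply/cvgnyPge => A; near=> j.
    rewrite (@leq_trans j)//; first by near: j; exact: nbhs_infty_ge.
    by rewrite (leq_trans (ltnW (ltn_expl j (isT : 1 < 4)%N)))// leq_pmull.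
  have : c%:R * ((c * 4 ^ j)%:R^-1 * u (c * 4 ^ j)%N) @[j --> \oo] --> c%:R * x.
    by apply: cvgMr; exact: (cvg_comp _ _ c4 ux).
  apply: cvg_trans; apply: near_eq_cvg; apply: nearW => j /=.
  rewrite natrM natrX invfM !mulrA mulfV ?mul1r//.
  by rewrite pnatr_eq0 -lt0n.
(* The gap [2m 4^j, 4m 4^j) adds nothing to the restricted sum, so 2m l = 4m l. *)
have l0 : l = 0.
  have e : (fun j => (4 ^+ j)^-1 * \sum_(0 <= k < 2 * m * 4 ^ j)
        (if sparse m k then h k else 0)) =
      (fun j => (4 ^+ j)^-1 * \sum_(0 <= k < m * 4 ^ j.+1)
        (if sparse m k then h k else 0)).
    apply/funext => j; congr (_ * _).
    have le1 : (2 * m * 4 ^ j <= m * 4 ^ j.+1)%N.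
      rewrite expnS mulnCA -mulnA leq_mul2r; lia.
    rewrite [RHS](big_cat_nat (leq0n _) le1)/= [X in _ = _ + X]big_nat.
    rewrite [X in _ = _ + X]big1 ?addr0// => k /andP[k1 k2].
    rewrite (@sparseF m j)// k2 andbT (leq_trans _ k1)//.
    by rewrite leq_mul2r; lia.
  have c2 := sub (2 * m)%N _ _ _ hl.
  have c4 := sub (4 * m)%N _ _ _ hl.
  have e2 : (2 * m)%:R * l = (4 * m)%:R * l.
    apply: (cvg_unique _ (c2 _)); rewrite ?muln_gt0//=.
    rewrite e; under eq_cvg do rewrite expnS mulnCA mulnA.
    by apply: c4; rewrite muln_gt0.
  have /eqP : (2 * m)%:R * l = 0 by move: e2; rewrite !natrM; lra.
  by rewrite mulf_eq0 pnatr_eq0 muln_eq0/= eqn0Ngt m0/= => /eqP.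
(* The increment over block j, divided by its length 4^j, keeps the limit of the averages. The
   restricted and the full sums have the same increment there, which forces l = d. *)
have diff (u : nat -> R) (x : R) : n%:R^-1 * u n @[n --> \oo] --> x ->
    (4 ^+ j)^-1 * (u (m.+1 * 4 ^ j)%N - u (m * 4 ^ j)%N) @[j --> \oo] --> x.
  move=> ux; have -> : x = m.+1%:R * x - m%:R * x.
    by rewrite -mulrBl -natrB// subSnn mul1r.
  under eq_cvg do rewrite mulrBr.
  exact: cvgB (sub m.+1 _ _ isT ux) (sub m _ _ m0 ux).
move/eqP: d0; apply; rewrite -l0.
apply: (cvg_unique _ (diff _ _ hd)) => //=.
apply: cvg_trans (diff _ _ hl); apply: near_eq_cvg; apply: nearW => j /=.
have le1 : (m * 4 ^ j <= m.+1 * 4 ^ j)%N by rewrite leq_mul2r leqnSn orbT.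
have split (u : nat -> R) : \sum_(0 <= k < m.+1 * 4 ^ j) u k -
    \sum_(0 <= k < m * 4 ^ j) u k = \sum_(m * 4 ^ j <= k < m.+1 * 4 ^ j) u k.
  by rewrite (big_cat_nat (leq0n _) le1)/= addrAC subrr add0r.
rewrite !split; congr (_ * _).
apply: eq_big_nat => k jk; rewrite ifT//.
by apply/asboolP; exists j.
Unshelve. all: by end_near. Qed.

(** * A Kraft inequality that ignores the positions in [P] *)

Section Kraft.
Context {R : realType} {K : nat}.
Variables (P : pred nat) (x0 : 'I_K).
Implicit Types u v : seq 'I_K.

Definition free_count (n : nat) : nat := \sum_(0 <= k < n) ~~ P k.

(** Only the common length is compared, so a short [v] is compatible with every [u] it does not yet
    contradict; the default [x0] of [nth] is never read. *)
Definition agree u v : bool :=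
  all (fun k => P k || (nth x0 u k == nth x0 v k))
      (iota 0 (minn (size u) (size v))).

(* The uniform probability, conditionally on the cylinder of v, that a sequence
   agrees with u at the positions of u outside P. *)
Definition cond_mass u v : R :=
  (agree u v)%:R * K%:R^-1 ^+ \sum_(size v <= k < size u) ~~ P k.

Lemma cond_mass_ge0 u v : 0 <= cond_mass u v.
Proof. by rewrite mulr_ge0// exprn_ge0// invr_ge0. Qed.

(** This is the martingale property. A next letter beyond [u] or at a position of [P] changes
    nothing; at any other position exactly one letter in K keeps the agreement, which accounts for
    one factor 1/K. *)
Lemma cond_mass_avg u v :
  cond_mass u v = \sum_(i < K) K%:R^-1 * cond_mass u (rcons v i).
Proof.
have K0 : (K%:R : R) != 0.
  by rewrite pnatr_eq0 -lt0n; case: (K) x0 => [[]|].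
have sumc (c : R) : \sum_(i < K) K%:R^-1 * c = c.
  by rewrite sumr_const card_ord -[LHS]mulr_natr mulrAC mulVf// mul1r.
rewrite /cond_mass; have [uv|vu] := leqP (size u) (size v).
  rewrite -[LHS]sumc; apply: eq_bigr => i _; congr (_ * (_%:R * _)).
    rewrite /agree size_rcons !(minn_idPl _)// ?leqW//.
    congr nat_of_bool; apply: eq_in_all => k; rewrite mem_iota add0n => /= ku.
    by rewrite nth_rcons (leq_trans ku).
  by rewrite !big_geq// size_rcons leqW.
have agreeS i : agree u (rcons v i) =
    agree u v && (P (size v) || (nth x0 u (size v) == i)).
  rewrite /agree size_rcons !(minn_idPr _)// ?(ltnW vu)//.
  rewrite -[in LHS]addn1 iotaD all_cat/= add0n andbT nth_rcons ltnn eqxx.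
  congr andb; apply: eq_in_all => k; rewrite mem_iota add0n => /= ku.
  by rewrite nth_rcons ku.
rewrite (big_ltn vu) exprD; under [RHS]eq_bigr do rewrite agreeS size_rcons.
case: (P (size v)) => /=.
  rewrite expr0 mul1r -[LHS]sumc.
  by under [RHS]eq_bigr do rewrite andbT.
rewrite (bigD1 (nth x0 u (size v)))//= eqxx andbT expr1.
rewrite [X in _ + X]big1 ?addr0; last first.
  by move=> i /negPf; rewrite eq_sym => ->; rewrite andbF mul0r mulr0.
by rewrite mulrCA.
Qed.

(* If the masses of the words of C summed to less than 1, then by averaging one
   could extend the empty word letter by letter keeping this strict inequality for
   the conditional masses, and the limit sequence would agree with no word of C. *)
Lemma kraft (A : R) (C : set (seq 'I_K)) : 0 <= A ->
  (forall z : nat -> 'I_K, exists2 u, C u &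
     forall k, (k < size u)%N -> ~~ P k -> nth x0 u k = z k) ->
  (A%:E <= \esum_(u in C) (A * K%:R^-1 ^+ free_count (size u))%:E)%E.
Proof.
move=> A0 cover; rewrite leNgt; apply/negP => small.
pose m v := (\esum_(u in C) (A * cond_mass u v)%:E)%E.
have t0 u v : (0 <= (A * cond_mass u v)%:E)%E.
  by rewrite lee_fin mulr_ge0// cond_mass_ge0.
have K0 : (0 < K)%N by case: (K) x0 => [[]|].
(* Since [m v] is the mean of its K extensions, they cannot all be at least [A]. *)
have step v : (m v < A%:E)%E -> exists i, (m (rcons v i) < A%:E)%E.
  move=> mv; apply/not_existsP => big; move: mv; apply/negP; rewrite -leNgt.
  have mE : (\sum_(i < K) m (rcons v i) = \sum_(i < K) m v)%E.
    rewrite -!esum_sum//; apply: eq_esum => u _.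
    rewrite !sumEFin -[in LHS]mulr_sumr.
    rewrite sumr_const card_ord cond_mass_avg -mulr_sumr.
    congr EFin; rewrite -[RHS]mulr_natr -[RHS]mulrA (mulrAC K%:R^-1).
    rewrite mulVf ?mul1r//.
    by rewrite pnatr_eq0 -lt0n.
  have [mv|//] := ltP (m v) A%:E.
  have mfin : m v \is a fin_num.
    by rewrite ge0_fin_numE ?esum_ge0// (lt_trans mv) ?ltry.
  have : (\sum_(i < K) A%:E <= \sum_(i < K) m v)%E.
    rewrite -mE; apply: lee_sum => i _.
    by have /negP := big i; rewrite -leNgt.
  rewrite -(fineK mfin) !sumEFin !sumr_const !card_ord !lee_fin.
  by rewrite lerMn2r eqn0Ngt K0/= -lee_fin fineK// leNgt mv.
(* By [step] the search succeeds along [pref]; [x0] only makes [next] total. *)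
pose next v := odflt x0 [pick i | (m (rcons v i) < A%:E)%E].
pose pref n := iter n (fun v => rcons v (next v)) [::].
have pref_lt n : (m (pref n) < A%:E)%E.
  elim: n => [|n ih] /=.
    apply: le_lt_trans small; apply: le_esum => u _.
    rewrite lee_fin ler_wpM2l// /cond_mass /agree minn0/= mul1r.
    by rewrite /free_count.
  rewrite /next; case: pickP => //= none.
  by have [i] := step _ ih; rewrite none.
pose z k := next (pref k).
have prefE n : pref n = mkseq z n.
  by elim: n => //= n ih; rewrite mkseqS -ih.
have [u Cu uz] := cover z.
(* The word [u] agrees with the prefix of [z] of its own length, so its conditional mass is 1 and
   this single term already contributes [A]. *)
have := pref_lt (size u); apply/negP; rewrite -leNgt prefE.
apply: esum_ge; exists [set u].
  by split; [exact: finite_set1|move=> _ ->].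
rewrite fsbig_set1 lee_fin /cond_mass size_mkseq big_geq// expr0 mulr1.
suff -> : agree u (mkseq z (size u)) by rewrite mulr1.
rewrite /agree size_mkseq minnn.
apply/allP => k; rewrite mem_iota add0n => /= ku.
by case: (boolP (P k)) => //= nP; rewrite nth_mkseq// uz.
Qed.

End Kraft.

(** * Overwritten sequences *)

Definition overwrite (K : nat) (P : pred nat) (c : 'I_K) (z : nat -> 'I_K) :
    nat -> 'I_K :=
  fun k => if P k then c else z k.

(** If both averages converged, so would their difference, in which the terms outside [P] cancel. *)
Lemma overwrite_divergence (R : realType) (N K : nat) (w : nat -> 'I_N)
    (f : 'I_N -> 'I_K -> R) (P : pred nat) (a b : 'I_K) (z : nat -> 'I_K) :
  ~ cvg (n%:R^-1 * \sum_(0 <= k < n)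
           (if P k then f (w k) b - f (w k) a else 0) @[n --> \oo]) ->
  divergence_set w f (overwrite P a z) \/ divergence_set w f (overwrite P b z).
Proof.
move=> dvg; apply: contrapT => /not_orP[/contrapT ca /contrapT cb]; apply: dvg.
pose avg c n : R := n%:R^-1 * \sum_(0 <= k < n) f (w k) (overwrite P c z k).
rewrite (_ : (fun n : nat => _) = (fun n => avg b n - avg a n)).
  exact: is_cvgB cb ca.
apply/funext => n; rewrite -mulrBr -sumrB; congr (_ * _); apply: eq_bigr => k _.
by rewrite /overwrite; case: (P k) => //; rewrite subrr.
Qed.

(** * Upper and lower bounds for the entropy measure *)

Section Entropy.
Context {R : realType} {K : nat}.
Implicit Types (s : R) (E : set (nat -> 'I_K)).

Lemma entropy_premeasure_nondecreasing s E :
  {homo (fun r => entropy_premeasure s r E) : r t / (r <= t)%N >-> (r <= t)%E}.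
Proof.
move=> r t rt; apply: ereal_inf_le_tmp => _ [C [Ct EC] <-]; exists C => //.
by split=> // u /Ct; exact: leq_ltn_trans.
Qed.

Lemma entropy_premeasure_le_measure s r E :
  (entropy_premeasure s r E <= entropy_measure s E)%E.
Proof.
have nd := @entropy_premeasure_nondecreasing (s) E.
rewrite /entropy_measure (cvg_lim _ (ereal_nondecreasing_cvgn nd))//.
by apply: ereal_sup_ubound; exists r.
Qed.

(** All K^(r+1) words of length r + 1 form a cover, each of weight K^-(r+1). *)
Lemma entropy_measure_ln_le1 E : (0 < K)%N ->
  (entropy_measure (ln K%:R : R) E <= 1)%E.
Proof.
move=> K0.
have nd := @entropy_premeasure_nondecreasing (ln K%:R) E.
rewrite /entropy_measure (cvg_lim _ (ereal_nondecreasing_cvgn nd))//.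
apply: ge_ereal_sup => _ [r _ <-].
pose C := (@tval r.+1 'I_K) @` setT.
apply: (@le_trans _ _ (\esum_(u in C) (expR (- ln K%:R * (size u)%:R))%:E)%E).
  apply: ereal_inf_lbound; exists C => //; split=> [_ [u _ <-]|x _].
    by rewrite size_tuple.
  exists (mkseq x r.+1); last first.
    change (mkseq x (size (mkseq x r.+1)) = mkseq x r.+1).
    by rewrite size_mkseq.
  by exists (Tuple (introT eqP (size_mkseq x r.+1))).
rewrite esum_image; last by move=> u v _ _ /val_inj.
rewrite (_ : setT = [set` enum {: r.+1.-tuple 'I_K}]); last first.
  by apply/seteqP; split=> t _ //=; rewrite mem_enum.
rewrite esum_fset//= -fsbig_seq ?enum_uniq//= big_enum/=.
under eq_bigr do rewrite size_tuple.
rewrite sumEFin sumr_const card_tuple card_ord lee_fin mulNr expRN expRM_natr.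
rewrite lnK ?posrE ?ltr0n// -[X in X <= _]mulr_natr natrX mulVf//.
by rewrite expf_neq0// pnatr_eq0 -lt0n.
Qed.

(** For words of length n > r, e^(-s n) >= e^((s'-s) r) e^(-s' n), and the last factor is at least K
    to the power minus [free_count P n]. By [fill], a cover of [E] meets the hypothesis of [kraft],
    so its sum is at least e^((s'-s) r), which is unbounded in r. *)
Lemma entropy_measure_pinfty (P : pred nat) (x0 : 'I_K) E s s' : s < s' ->
  (forall n, s' * n%:R <= ln K%:R * (free_count P n)%:R) ->
  (forall z : nat -> 'I_K,
     exists2 y, E y & forall k, ~~ P k -> y k = z k) ->
  entropy_measure s E = +oo%E.
Proof.
move=> ss' free fill.
have K0 : (0 < K)%N by case: (K) x0 => [[]|].
have ge r : ((expR ((s' - s) * r%:R))%:E <= entropy_measure s E)%E.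
  apply: le_trans (entropy_premeasure_le_measure s r E).
  apply: le_ereal_inf_tmp => _ [C [Cr EC] <-].
  apply: (@le_trans _ _ (\esum_(u in C) (expR ((s' - s) * r%:R) *
      K%:R^-1 ^+ free_count P (size u))%:E)%E).
    apply: (kraft (x0 := x0)); first exact: expR_ge0.
    move=> z; have [y /EC[u Cu uy] yz] := fill z; exists u => // k ku Pk.
    by rewrite -uy nth_mkseq// yz.
  apply: le_esum => u /Cr ru.
  rewrite lee_fin -[K%:R]lnK ?posrE ?ltr0n// -expRN -expRM_natr -expRD ler_expR.
  have : (s' - s) * r%:R <= (s' - s) * (size u)%:R.
    by rewrite ler_wpM2l ?subr_ge0 ?(ltW ss')// ler_nat ltnW.
  have := free (size u); rewrite mulrBl mulNr; lra.
apply/eqyP => A A0.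
have d0 : 0 < s' - s by rewrite subr_gt0.
apply: le_trans (ge (Num.bound (A / (s' - s)))); rewrite lee_fin.
apply: le_trans (expR_ge1Dx _); apply: ler_wpDl => //.
by rewrite mulrC -ler_pdivrMr// ltW// archi_boundP// divr_ge0// ltW.
Qed.

End Entropy.

(** * Density of the free positions and the entropy of the divergence set *)

Lemma free_count_sparse_ge (R : realType) (m n : nat) : (0 < m)%N ->
  (1 - 2 / m%:R) * n%:R <= (free_count (sparse m) n)%:R :> R.
Proof.
move=> m0; have mR : (0 : R) < m%:R by rewrite ltr0n.
set c := (\sum_(0 <= k < n) sparse m k)%N.
have eqn : (free_count (sparse m) n + c)%N = n.
  rewrite /free_count /c -big_split/= -[RHS]subn0 -[RHS]muln1.
  by rewrite -sum_nat_const_nat; apply: eq_bigr => k _; case: (sparse m k).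
have := sparse_count n m0; rewrite -/c -(ler_nat R) !natrM -ler_pdivlMl//.
move=> cle.
rewrite -[in leLHS]eqn natrD.
move: cle; rewrite -[in X in X -> _]eqn natrD.
set F := (free_count _ _)%:R => cle.
have -> : (1 - 2 / m%:R) * (F + c%:R) = F + c%:R - m%:R^-1 * (2 * (F + c%:R)).
  by ring.
lra.
Qed.

Theorem theorem2p7 (R : realType) (N K : nat) (q : 'I_N -> R)
    (w : nat -> 'I_N) (f : 'I_N -> 'I_K -> R)
    (hq : probability_vector q)
    (hw : frequency_regular q w)
    (hg : ~ exists c : R, forall i : 'I_K, \sum_(j < N) q j * f j i = c) :
  htop R (divergence_set w f) = (ln (K%:R : R))%:E.
Proof.
have [a [b gab]] : exists a b, \sum_j q j * f j a != \sum_j q j * f j b.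
  (* Over an empty alphabet any constant works, so [hg] excludes that case too. *)
  apply: contrapT => eqg; apply: hg; case: (K) f eqg => [|K'] f' eqg.
    by exists 0 => -[].
  exists (\sum_j q j * f' j ord0) => i; apply/eqP; apply: contrapT => /negP ne.
  by apply: eqg; exists i, ord0.
have K1 : (1 < K)%N.
  rewrite ltnNge; apply/negP => K1; move/eqP: gab; apply.
  suff -> : a = b by [].
  by apply: ord_inj; move: (ltn_ord a) (ltn_ord b); lia.
have lnK0 : 0 < ln (K%:R : R) by rewrite ln_gt0// ltr1n.
have fill m (z : nat -> 'I_K) : (0 < m)%N ->
    exists2 y, divergence_set w f y & forall k, ~~ sparse m k -> y k = z k.
  move=> m0.
  have dvg : ~ cvg (n%:R^-1 * \sum_(0 <= k < n)
      (if sparse m k then f (w k) b - f (w k) a else 0) @[n --> \oo]).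
    apply: (@sparse_avg_diverges R (fun k => f (w k) b - f (w k) a)
      (\sum_j (f j b - f j a) * q j)) => //.
      apply: contra gab; under eq_bigr do rewrite mulrBl !(mulrC _ (q _)).
      by rewrite sumrB subr_eq0 eq_sym.
    exact: (@avg_frequency_regular R N q (fun j => f j b - f j a) w hw).
  have fillc c k : ~~ sparse m k -> overwrite (sparse m) c z k = z k.
    by rewrite /overwrite => /negPf ->.
  by case: (overwrite_divergence z dvg) => Dz;
    eexists; [exact: Dz|exact: fillc|exact: Dz|exact: fillc].
(* Filling any sequence with m = 1 shows that the divergence set is nonempty. *)
rewrite /htop; case: asboolP => [D0|_].
  by have [y] := fill 1%N (fun=> a) isT; rewrite D0.
apply/eqP; rewrite eq_le; apply/andP; split.
  apply: ereal_inf_lbound; exists (ln K%:R) => //; split; first exact: ltW.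
  by rewrite (le_lt_trans (entropy_measure_ln_le1 _ _)) ?ltry// ltnW.
apply: le_ereal_inf_tmp => _ [s [s0 sfin] <-]; rewrite lee_fin leNgt.
apply/negP => slt; move: sfin; apply/negP.
have d0 : 0 < ln K%:R - s by rewrite subr_gt0.
(* This makes 2 ln K / m < ln K - s, that is, s < (1 - 2/m) ln K, so the measure at exponent s is
   infinite. *)
pose m := Num.bound (2 * ln (K%:R : R) / (ln K%:R - s)).
have mlt : 2 * ln (K%:R : R) / (ln K%:R - s) < m%:R.
  by rewrite archi_boundP// divr_ge0 ?mulr_ge0 ?(ltW lnK0) ?(ltW d0).
have mR : (0 : R) < m%:R.
  by apply: le_lt_trans mlt; rewrite divr_ge0 ?mulr_ge0 ?(ltW lnK0) ?(ltW d0).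
have m0 : (0 < m)%N by rewrite -(ltr0n R).
rewrite (@entropy_measure_pinfty _ _ (sparse m) a _ _
  (ln K%:R * (1 - 2 / m%:R))) ?ltxx//.
- have : 2 * ln (K%:R : R) / m%:R < ln K%:R - s.
    by rewrite ltr_pdivrMr// [ltRHS]mulrC -ltr_pdivrMr.
  lra.
- by move=> n; rewrite -mulrA ler_pM2l// free_count_sparse_ge.
- by move=> z; exact: fill.
Qed.
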